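(* Let $h(t)=te^{-t}$. There is an absolute constant $C>0$ such that for every dimension $n\ge1$ and every $k\ge0$ there exist $T_0>0$ (small) and $a_0>0$ (large) with the following property: for all $0<T_-<T^+\le T_0$, all $a\ge a_0$ and all real-valued $u\in C_c^\infty\big(\mathbb{R}^n\times(T_-,T^+)\big)$, $$\int_{\mathbb{R}^n\times(T_-,T^+)}h(t)^{-(2a+1)}(1+|x|^2)^{-k}\Big((a+1)u^2+|\nabla u|^2\Big)\,dx\,dt\le C\int_{\mathbb{R}^n\times(T_-,T^+)}h(t)^{-2a}(1+|x|^2)^{-k}|\partial_tu+\Delta u|^2\,dx\,dt.$$
   Context: $\nabla$ and $\Delta$ act in the spatial variable $x\in\mathbb{R}^n$ only. *)

(* Defs.v *)
From HB Require Import structures.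
From mathcomp Require Import all_boot all_order all_algebra.
From mathcomp Require Import all_classical all_reals all_analysis.

Set Implicit Arguments.
Unset Strict Implicit.
Unset Printing Implicit Defensive.

Import Order.TTheory GRing.Theory Num.Theory.
Import numFieldNormedType.Exports.

Local Open Scope classical_set_scope.
Local Open Scope ring_scope.

Section lebesgue_tuple.
Context {R : realType}.

Local Notation RR := (measurableTypeR R).

Definition cons_pair n (p : RR * n.-tuple RR) : n.+1.-tuple RR :=
  [the n.+1.-tuple RR of p.1 :: p.2].

Lemma measurable_cons_pair n : measurable_fun setT (@cons_pair n).
Proof. exact: measurable_cons. Qed.

Section cons_measure.
Variables (n : nat) (m : {sigma_finite_measure set (n.-tuple RR) -> \bar R}).

Definition cons_measure : set (n.+1.-tuple RR) -> \bar R :=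
  pushforward (lebesgue_measure \x m)%E (@cons_pair n).

Let cons_measure0 : cons_measure set0 = 0%E.
Proof. by rewrite /cons_measure /pushforward preimage_set0 measure0. Qed.

Let cons_measure_ge0 A : (0 <= cons_measure A)%E.
Proof. by rewrite /cons_measure /pushforward; exact: measure_ge0. Qed.

Let cons_measure_sigma_additive : semi_sigma_additive cons_measure.
Proof.
move=> F mF tF mUF; rewrite /cons_measure /pushforward preimage_bigcup.
have mc := @measurable_cons_pair n.
apply: measure_semi_sigma_additive.
- by move=> k; rewrite -[X in measurable X]setTI; exact: mc.
- apply/trivIsetP => /= i j _ _ ij; rewrite -preimage_setI.
  by move/trivIsetP : tF => /(_ _ _ _ _ ij) ->//; rewrite preimage_set0.
- by rewrite -preimage_bigcup -[X in measurable X]setTI; exact: mc.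
Qed.

HB.instance Definition _ := isMeasure.Build _ _ _ cons_measure
  cons_measure0 cons_measure_ge0 cons_measure_sigma_additive.

Let cons_measure_sigma_finite : sigma_finite setT cons_measure.
Proof.
have /sigma_finiteP[F [FT ndF Foo]] :=
  sigma_finiteT (@lebesgue_measure R : {sigma_finite_measure set RR -> \bar R}).
have /sigma_finiteP[G [GT ndG Goo]] := sigma_finiteT m.
pose uncons (x : n.+1.-tuple RR) : RR * n.-tuple RR :=
  (thead x, [tuple of behead x]).
have muncons : measurable_fun setT uncons.
  apply/measurable_fun_pairP; split.
    exact: (@measurable_tnth _ RR n.+1 ord0).
  exact: measurable_behead.
have consK : cancel (@cons_pair n) uncons.
  by move=> [a t]; congr (_, _); exact/val_inj.
exists (fun k => uncons @^-1` (F k `*` G k)).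
  rewrite -preimage_bigcup (_ : \bigcup_k _ = setT) ?preimage_setT//.
  rewrite -setXTT FT GT; apply/seteqP; split => -[x y] /=.
    by move=> [k _ []/= ? ?]; split; exists k.
  move=> [[k _ Fkx] [l _ Gly]]; exists (maxn k l) => //; split => /=.
    by move: x Fkx; exact/subsetPset/ndF/leq_maxl.
  by move: y Gly; exact/subsetPset/ndG/leq_maxr.
move=> k; have [mF Fkoo] := Foo k; have [mG Gkoo] := Goo k; split.
  by rewrite -[X in measurable X]setTI; apply: muncons => //; exact: measurableX.
rewrite /cons_measure /pushforward -comp_preimage.
rewrite (_ : uncons \o _ = idfun) ?preimage_id; last exact/funext.
by rewrite product_measure1E// lte_mul_pinfty// ge0_fin_numE.
Qed.

HB.instance Definition _ := Measure_isSigmaFinite.Build _ _ _ cons_measure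
  cons_measure_sigma_finite.

End cons_measure.

(* n-dimensional Lebesgue measure, as the n-fold product of Lebesgue
   measure on R (the unit mass at the empty tuple when n = 0) *)
Fixpoint lebesgue_tuple n : {sigma_finite_measure set (n.-tuple RR) -> \bar R} :=
  match n with
  | 0 => [the sigma_finite_measure _ _ of @dirac _ (0.-tuple RR) [tuple] R]
  | n'.+1 => [the sigma_finite_measure _ _ of cons_measure (lebesgue_tuple n')]
  end.

Lemma lebesgue_tuple_box n (A : 'I_n -> set R) :
  (forall i, measurable (A i : set RR)) ->
  lebesgue_tuple n [set x | forall i, A i (tnth x i)]
  = (\prod_(i < n) lebesgue_measure (A i))%E.
Proof.
elim: n A => [|n IH] A mA.
  rewrite big_ord0 /= diracE; case: (_ \in _) / idP => //.
  by case; rewrite inE => -[].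
have mB m (B : 'I_m -> set R) : (forall i, measurable (B i : set RR)) ->
    measurable ([set x | forall i, B i (tnth x i)] : set (m.-tuple RR)).
  move=> mB; rewrite (_ : [set x | _] =
      \bigcap_(i in [set: 'I_m]) ((fun x : m.-tuple RR => tnth x i) @^-1` B i)).
    apply: fin_bigcap_measurable; first exact: finite_finset.
    move=> i _; rewrite -[X in measurable X]setTI.
    exact: (@measurable_tnth _ RR m i).
  by apply/seteqP; split => x /= H i => [_|]; exact: H.
rewrite big_ord_recl -IH//= /cons_measure /pushforward.
rewrite -product_measure1E//; last first.
  by apply: (mB n (fun i => A (lift ord0 i))) => i; exact: mA.
congr (product_measure1 _ _ _); apply/seteqP; split => -[a t] /=.
  move=> H; split; first exact: (H ord0).
  by move=> i; have := H (lift ord0 i); rewrite /cons_pair tnthS.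
move=> [ha ht] i; case: (unliftP ord0 i) => [j ->|->]; last exact: ha.
by rewrite /cons_pair tnthS; exact: ht.
Qed.

End lebesgue_tuple.

(* Points of R^n x R are pairs (x, t) : 'rV[R]_n * R with the product topology;
   the library norm on 'rV[R]_n is the sup norm, hence the separate
   sqnorm for the Euclidean |x|^2. *)
Section space_time.
Context {R : realType}.

(* Meant for finite-dimensional V, where continuity of the iterated directional
   derivatives up to order k is the usual C^k, and in particular gives
   differentiability and continuity of f. *)
Fixpoint Ck (V : normedModType R) (k : nat) (f : V -> R) : Prop :=
  match k with
  | 0 => continuous f
  | k'.+1 => forall v : V, (forall x, derivable f x v) /\ Ck k' ('D_v f)
  end.

Definition smooth (V : normedModType R) (f : V -> R) : Prop :=
  forall k, Ck k f.

Definition tsupport (V : normedModType R) (f : V -> R) : set V :=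
  closure [set x | f x != 0].

Variable n : nat.
Implicit Types u : 'rV[R]_n * R -> R.

(* Elements of C_c^oo(R^n x (Tm, Tp)), extended by zero to R^n x R. *)
Definition test_function (Tm Tp : R) u : Prop :=
  [/\ smooth u, compact (tsupport u) &
      tsupport u `<=` [set: 'rV[R]_n] `*` `]Tm, Tp[].

Definition sqnorm (x : 'rV[R]_n) : R := \sum_(i < n) x ord0 i ^+ 2.

Definition dir_x (i : 'I_n) : 'rV[R]_n * R := (delta_mx ord0 i, 0).
Definition dir_t : 'rV[R]_n * R := (0, 1).

Definition dt u : 'rV[R]_n * R -> R := 'D_dir_t u.

Definition grad_x u (z : 'rV[R]_n * R) : 'rV[R]_n :=
  \row_(i < n) 'D_(dir_x i) u z.

Definition laplacian_x u (z : 'rV[R]_n * R) : R :=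
  \sum_(i < n) 'D_(dir_x i) ('D_(dir_x i) u) z.

Definition row_of_tuple (x : n.-tuple R) : 'rV[R]_n :=
  \row_(i < n) tnth x i.

(* The integral over R^n x (Tm, Tp) with respect to dx dt. *)
Definition slab_integral (Tm Tp : R) (f : 'rV[R]_n * R -> R) : \bar R :=
  (\int[lebesgue_tuple n \x lebesgue_measure]_(z in [set: n.-tuple R] `*` `]Tm, Tp[)
    (f (row_of_tuple z.1, z.2))%:E)%E.

End space_time.

Definition h {R : realType} (t : R) : R := t * expR (- t).

(* Main.v *)
Require Import Defs.
From HB Require Import structures.
From mathcomp Require Import all_boot all_order all_algebra.
From mathcomp Require Import all_classical all_reals all_analysis.
From mathcomp Require Import measurable_realfun ring lra.

(** Write p = h^(-2a), w = (1 + |x|^2)^(-k), q = a h'/h = a (1/t - 1),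
    b = grad w / w, and let A u = Lap u + b . grad u = w^-1 div (w grad u) be the
    Laplacian made symmetric for the measure w dx. Substituting u = h^a f turns
    the operator d_t + A into the sum of d_t, antisymmetric, and A + q,
    symmetric. Expressed in u, the two parts are Z = u_t - q u and Y = A u + q u,
    and the cross term of (Y + Z)^2 is governed by the commutator -q' = a / t^2:
    modulo derivatives of compactly supported functions,
      2 p w Y Z  is  (a / t^2) p w u^2.
    Hence the integral of p w (u_t + A u)^2 equals that of
    p w (Y^2 + Z^2 + (a / t^2) u^2), and the last term already controls
    (a + 1) u^2 / h, because 1/h is at most 2/t for small t. For the gradient,
    again modulo derivatives,
      (p w / h) |grad u|^2  is  - (p w / h) u A u = (p w / h) (q u^2 - u Y),
    which is bounded by the same quantities since q / h <= a / t^2. It remains to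
    return from A to Lap: |b| <= k, so (b . grad u)^2 <= k^2 h (|grad u|^2 / h),
    and h <= T0 lets the left-hand side absorb this once T0 is of size 1/k^2.
    That is the only place where k enters, and it leaves C absolute.

    The two integrations by parts are bundled in one function,
    [carleman_density], a sum of derivatives whose integral over the slab is zero
    ([carleman_identity]); what is left is an inequality between quadratic
    polynomials at each point ([carleman_pointwise]). That the integral of a
    derivative vanishes is the fundamental theorem of calculus on coordinate lines
    followed by Fubini ([slab_integral_dx], [slab_integral_dt]), and the cross
    term needs the symmetry of the mixed derivatives in x_i and t
    ([smooth_derive_comm]). *)

Set Implicit Arguments.
Unset Strict Implicit.
Unset Printing Implicit Defensive.

Import Order.TTheory GRing.Theory Num.Theory.
Import numFieldNormedType.Exports.

Local Open Scope classical_set_scope.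
Local Open Scope ring_scope.

(** * Integrals over tuples along coordinate lines *)

Section bounded_support.
Context d (T : measurableType d) (R : realType).
Variable mu : {measure set T -> \bar R}.

Lemma bounded_support_integrable (A : set T) (F : T -> R) (M : R) :
  measurable A -> (mu A < +oo)%E -> measurable_fun setT F ->
  (forall x, `|F x| <= M) -> (forall x, ~ A x -> F x = 0) ->
  mu.-integrable setT (EFin \o F).
Proof.
move=> mA muA mF FM FA.
have -> : EFin \o F = (EFin \o F) \_ A.
  apply/funext => x; rewrite patchE /=; case: ifPn => // /negP.
  by rewrite inE => /FA ->.
apply/(integrable_restrict mu mA measurableT); rewrite setTI.
apply: measurable_bounded_integrable => //.
- exact: measurable_funTS.
- by exists M; split; rewrite ?num_real// => y My x _ /=; exact: le_trans (ltW My).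
Qed.

End bounded_support.

Section tuple_box.
Context {R : realType}.
Local Notation RR := (measurableTypeR R).

Definition tuple_box n (B : R) : set (n.-tuple RR) :=
  [set x | forall i, `[- B, B]%classic (tnth x i)].
Arguments tuple_box : clear implicits.

Lemma measurable_tuple_box n B : measurable (tuple_box n B).
Proof.
rewrite (_ : tuple_box n B =
    \bigcap_(i in [set: 'I_n]) ((fun x : n.-tuple RR => tnth x i) @^-1` `[- B, B])).
  apply: fin_bigcap_measurable; first exact: finite_finset.
  move=> i _; rewrite -[X in measurable X]setTI.
  by apply: (@measurable_tnth _ RR n i) => //; exact: measurable_itv.
by apply/seteqP; split => x /= H i => [_|]; exact: H.
Qed.

Lemma lebesgue_tuple_box_lty n B : (@lebesgue_tuple R n (tuple_box n B) < +oo)%E.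
Proof.
rewrite (lebesgue_tuple_box (A := fun=> `[- B, B]%classic)); last first.
  by move=> i; exact: measurable_itv.
apply: (big_ind (fun x : \bar R => x < +oo /\ 0 <= x)%E _ _ _).1 => //.
- by rewrite ltry lee_fin.
- by move=> x y [xoo x0] [yoo y0]; rewrite mule_ge0// lte_mul_pinfty// ge0_fin_numE.
- move=> i _; rewrite measure_ge0; split => //.
  by rewrite lebesgue_measure_itv/=; case: ifPn => // _; rewrite -EFinB ltry.
Qed.

Lemma tuple_box_cons n B (s : RR) (x : n.-tuple RR) :
  tuple_box n.+1 B [tuple of s :: x] -> tuple_box n B x.
Proof. by move=> H i; have := H (lift ord0 i); rewrite tnthS. Qed.

Definition set_tnth n (x : n.-tuple RR) (i : 'I_n) (s : RR) : n.-tuple RR :=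
  [tuple if j == i then s else tnth x j | j < n].

Lemma set_tnth_cons0 n (a s : RR) (x : n.-tuple RR) :
  set_tnth [tuple of a :: x] ord0 s = [tuple of s :: x].
Proof.
apply/eq_from_tnth => j; rewrite tnth_mktuple.
by case: (unliftP ord0 j) => [j' ->|->//]; rewrite !tnthS.
Qed.

Lemma set_tnth_consS n (a s : RR) (x : n.-tuple RR) i :
  set_tnth [tuple of a :: x] (lift ord0 i) s = [tuple of a :: set_tnth x i s].
Proof.
apply/eq_from_tnth => j; rewrite tnth_mktuple.
case: (unliftP ord0 j) => [j' ->|->//].
by rewrite !tnthS tnth_mktuple (inj_eq (@lift_inj _ _)).
Qed.

(** By induction on the dimension: the measure on tuples peels off one coordinate
    at a time, so either the chosen coordinate is the one peeled off, and Fubini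
    integrates along it first, or it belongs to the tail, and the induction
    hypothesis applies to every slice. The bound and the bounded support, which
    slices inherit, keep all slices integrable; integrability alone would only
    survive for almost every slice. *)
Lemma integral_tuple_lines0 n (F : n.-tuple RR -> R) (i : 'I_n) (B M : R) :
  measurable_fun setT F -> (forall x, `|F x| <= M) ->
  (forall x, ~ tuple_box n B x -> F x = 0) ->
  (forall x, (\int[lebesgue_measure]_s (F (set_tnth x i s))%:E = 0)%E) ->
  (\int[lebesgue_tuple n]_x (F x)%:E = 0)%E.
Proof.
elim: n F i => [F []//|n IH F i mF FM FB F0].
have mc := @measurable_cons_pair R n.
have mFc : measurable_fun setT (F \o @cons_pair R n) by exact: measurableT_comp.
have iFc : (lebesgue_measure \x lebesgue_tuple n)%E.-integrable setT
    (EFin \o (F \o @cons_pair R n)).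
  apply: (@bounded_support_integrable _ (RR * n.-tuple RR)%type R _
    ((`[- B, B]%classic : set RR) `*` tuple_box n B) (F \o @cons_pair R n) M) => //.
  - by apply: measurableX; [exact: measurable_itv|exact: measurable_tuple_box].
  - have H1 := lebesgue_tuple_box_lty n B.
    have H2 : (lebesgue_measure (`[(-B)%R, B] : set RR) < +oo)%E.
      by rewrite lebesgue_measure_itv/=; case: ifPn => // _; rewrite -EFinB ltry.
    rewrite /= product_measure1E; [|exact: measurable_itv|exact: measurable_tuple_box].
    by rewrite lte_mul_pinfty// ge0_fin_numE.
  - by move=> z; exact: FM.
  - move=> [s x] /= nB; apply: FB => Bsx; apply: nB; split.
      by have := Bsx ord0.
    exact: tuple_box_cons Bsx.
rewrite [LHS](_ : _ =
   \int[(lebesgue_measure \x lebesgue_tuple n)%E]_z (F (cons_pair z))%:E)%E; last first.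
  rewrite -[RHS](@integral_pushforward _ _ _ _ _ _ mc _ setT (EFin \o F)) //.
  exact/measurable_EFinP.
have mF1 s : measurable_fun setT (fun x => F (cons_pair (s, x))).
  by apply: measurableT_comp mFc _; exact: pair1_measurable.
case: (unliftP ord0 i) F0 => [j ->|->] F0.
- rewrite -(integral12_prod_meas1 iFc)/= integral0_eq// => s _.
  rewrite /fubini_F /=; apply: (IH (fun x => F (cons_pair (s, x))) j) => //.
    move=> x nB; apply: FB => Bsx; apply: nB; exact: tuple_box_cons Bsx.
  move=> x; rewrite -[RHS](F0 (cons_pair (s, x))).
  by apply: eq_integral => r _; rewrite set_tnth_consS.
- rewrite -(integral21_prod_meas1 iFc)/= integral0_eq// => x _.
  rewrite /fubini_G /= -[RHS](F0 (cons_pair (0, x))).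
  by apply: eq_integral => r _; rewrite set_tnth_cons0.
Qed.

End tuple_box.
Arguments tuple_box {R} n B.

(** * Measurability of continuous functions of tuples *)

(** Every preimage under [g \o e] is a countable union of fibres of [e]. *)
Lemma measurable_countable_factor d (T : measurableType d) (R : realType)
    (C : countType) (e : T -> C) (g : C -> R) :
  (forall c, measurable (e @^-1` [set c])) -> measurable_fun setT (g \o e).
Proof.
move=> me _ Y _; rewrite setTI.
rewrite (_ : _ @^-1` Y =
    \bigcup_(c in [set: C]) (if g c \in Y then e @^-1` [set c] else set0)).
  by apply: countable_bigcupT_measurable => // c; case: ifP.
apply/seteqP; split => x /=.
  by move=> Yx; exists (e x) => //; rewrite mem_set.
by move=> [c _]; case: ifPn => // /set_mem Yc /= ->.
Qed.

Section continuous_measurable.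
Context {R : realType} (n : nat).
Local Notation RR := (measurableTypeR R).

(** The cell of the grid of mesh 1/(m+1) that contains the point. *)
Definition grid_code (m : nat) (z : n.-tuple RR * RR) : {ffun 'I_n -> int} * int :=
  ([ffun j => Num.floor (tnth z.1 j * m.+1%:R)], Num.floor (z.2 * m.+1%:R)).

Definition grid_point (m : nat) (c : {ffun 'I_n -> int} * int) : 'rV[R]_n * R :=
  (\row_j ((c.1 j)%:~R / m.+1%:R), c.2%:~R / m.+1%:R).

Definition space_time_point (z : n.-tuple RR * RR) : 'rV[R]_n * R :=
  (row_of_tuple z.1, z.2).

Lemma measurable_grid_code m c : measurable (grid_code m @^-1` [set c]).
Proof.
have mfloor (g : n.-tuple RR * RR -> RR) (k : int) : measurable_fun setT g ->
    measurable [set z | Num.floor (g z * m.+1%:R) = k].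
  move=> mg; rewrite (_ : [set z | _] =
      (fun z => g z * m.+1%:R) @^-1` `[k%:~R, (k + 1)%:~R[%classic).
    rewrite -[X in measurable X]setTI.
    have mgm : measurable_fun setT (fun z => g z * m.+1%:R : R).
      by apply: measurable_funM => //; exact: measurable_cst.
    exact: (mgm measurableT _ (measurable_itv `[k%:~R, (k + 1)%:~R[)).
  apply/seteqP; split => z /=; rewrite in_itv /=.
    by move=> <-; exact: floor_itv.
  by rewrite -floor_eq => /eqP.
rewrite (_ : _ @^-1` _ =
    (\bigcap_(j in [set: 'I_n]) [set z | Num.floor (tnth z.1 j * m.+1%:R) = c.1 j])
    `&` [set z | Num.floor (z.2 * m.+1%:R) = c.2]).
  apply: measurableI; last by apply: (mfloor snd).
  apply: fin_bigcap_measurable; first exact: finite_finset.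
  move=> j _; apply: (mfloor (fun z => tnth z.1 j)).
  exact: (measurableT_comp (@measurable_tnth _ RR n j) measurable_fst).
apply/seteqP; split => z /=.
  by move=> <- /=; split => // j _ /=; rewrite ffunE.
move=> [H1 H2]; rewrite /grid_code H2; case: c H1 {H2} => c1 c2 /= H1.
by congr (_, _); apply/ffunP => j; rewrite ffunE H1.
Qed.

Lemma floor_grid_dist (m : nat) (s : R) :
  `|s - (Num.floor (s * m.+1%:R))%:~R / m.+1%:R| <= m.+1%:R^-1.
Proof.
have m0 : (0 : R) < m.+1%:R by rewrite ltr0n.
have /andP[h1 h2] := floor_itv (s * m.+1%:R).
rewrite intrD1 in h2.
rewrite -[X in `|X - _|](mulfK (lt0r_neq0 m0)) -mulrBl normrM normfV.
rewrite (gtr0_norm m0) ger0_norm ?subr_ge0// -[leRHS]mul1r ler_pM2r ?invr_gt0//.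
by lra.
Qed.

Lemma mx_norm_le (x : 'rV[R]_n) (e : R) :
  0 <= e -> (forall j, `|x ord0 j| <= e) -> `|x| <= e.
Proof.
move=> e0 xe; rewrite /Num.norm /= mx_normrE; apply: bigmax_le => // -[i j] _ /=.
by rewrite (ord1 i).
Qed.

Lemma cvg_grid_point (z : n.-tuple RR * RR) :
  (fun m => grid_point m (grid_code m z)) @ \oo --> space_time_point z.
Proof.
have inv0 (e : R) : 0 < e -> \forall m \near \oo, (m.+1%:R^-1 : R) <= e.
  move=> e0; near=> m; apply: ltW; near: m.
  exact: (near_infty_natSinv_lt (PosNum e0)).
apply: (@cvg_pair _ _ _ \oo (nbhs (row_of_tuple z.1 : 'rV[R]_n)) (nbhs (z.2 : R))
    _ _ _ (fun m => (grid_point m (grid_code m z)).1)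
    (fun m => (grid_point m (grid_code m z)).2));
  apply/cvgrPdist_le => /= e /inv0; apply: filterS => m me.
  apply: le_trans me; apply: mx_norm_le => [|j].
    by rewrite invr_ge0 ler0n.
  by rewrite !mxE ffunE; exact: floor_grid_dist.
by apply: le_trans me; exact: floor_grid_dist.
Unshelve. all: by end_near. Qed.

(** The sigma-algebra on tuples is generated by the coordinates, while continuity
    refers to the topology of row vectors. The two are compared by rounding: the
    functions obtained by evaluating [f] at grid points are measurable, as they
    take countably many values on measurable cells, and they converge pointwise
    to [f] wherever it is continuous. *)
Lemma measurable_continuous_at (D : set (n.-tuple RR * RR)) (f : 'rV[R]_n * R -> R) :
  (forall z, D z -> {for space_time_point z, continuous f}) ->
  measurable_fun D (f \o space_time_point).
Proof.
move=> cf; apply: (@measurable_fun_cvg _ _ _ _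
    (fun m => (f \o grid_point m) \o grid_code m)).
  move=> m; apply: measurable_funTS; apply: measurable_countable_factor => c.
  exact: measurable_grid_code.
by move=> z Dz; exact: (cvg_comp _ _ (@cvg_grid_point z) (cf z Dz)).
Qed.

End continuous_measurable.
Arguments space_time_point {R n} z.

(** * Integrals over the slab *)

Section slab.
Context {R : realType} (n : nat) (Tm Tp : R).
Hypothesis Tm0 : 0 < Tm.
Local Notation RR := (measurableTypeR R).
Implicit Types f g : 'rV[R]_n * R -> R.

(** Continuity is required at positive times only, since the weights are singular
    at time zero; the slab stays away from it. *)
Definition continuous_pos f := forall z, 0 < z.2 -> {for z, continuous f}.

Definition vanishes_off (B : R) f :=
  forall z : 'rV[R]_n * R, (exists j, B < `|z.1 ord0 j|) -> f z = 0.

Lemma continuous_pos_bounded f B : continuous_pos f ->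
  exists M, forall z : 'rV[R]_n * R, (forall j, `|z.1 ord0 j| <= B) -> Tm <= z.2 <= Tp -> `|f z| <= M.
Proof.
move=> cf.
pose K : set ('rV[R]_n * R) :=
  [set v : 'rV[R]_n | forall j, `[- B, B]%classic (v ord0 j)] `*` `[Tm, Tp]%classic.
have cK : compact K.
  apply: compact_setX; last exact: segment_compact.
  by apply: (@rV_compact _ _ (fun=> `[- B, B]%classic)) => _; exact: segment_compact.
have : compact (f @` K).
  apply: continuous_compact => //; apply: continuous_in_subspaceT => z.
  rewrite inE => -[_ /=]; rewrite in_itv /= => /andP[h _].
  by apply: cf; exact: lt_le_trans h.
move=> /compact_bounded [M [_ HM]]; exists (M + 1) => z zB zT.
apply: HM; first by rewrite ltrDl.
exists z => //; split => /=; last by rewrite in_itv.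
by move=> j; rewrite in_itv /= -ler_norml; exact: zB.
Qed.

Definition slab_cut f (z : n.-tuple RR * RR) : R :=
  if Tm < z.2 < Tp then f (space_time_point z) else 0.

Definition slab_dom : set (n.-tuple RR * RR) :=
  [set: n.-tuple R] `*` `]Tm, Tp[%classic.

Lemma measurable_slab_dom : measurable slab_dom.
Proof. by apply: measurableX => //; exact: (measurable_itv `]Tm, Tp[). Qed.

Lemma slab_cut_patch f : EFin \o slab_cut f =
  (fun z : n.-tuple RR * RR => (f (row_of_tuple z.1, z.2))%:E) \_ slab_dom.
Proof.
apply/funext => z; rewrite patchE /= /slab_cut.
have -> : (z \in slab_dom) = (Tm < z.2 < Tp).
  by apply/idP/idP => [/set_mem[_]|zT]; [|apply/mem_set; split => //]; rewrite /= in_itv.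
by case: ifP.
Qed.

Lemma slab_integral_cut f : slab_integral Tm Tp f =
  (\int[lebesgue_tuple n \x lebesgue_measure]_z (slab_cut f z)%:E)%E.
Proof. by rewrite /slab_integral integral_mkcond -slab_cut_patch. Qed.

Lemma measurable_slab f : continuous_pos f ->
  measurable_fun slab_dom (f \o space_time_point).
Proof.
move=> cf; apply: measurable_continuous_at => z [_ /=].
by rewrite in_itv /= => /andP[h _]; apply: cf; exact: lt_trans h.
Qed.

Lemma measurable_slab_cut f : continuous_pos f -> measurable_fun setT (slab_cut f).
Proof.
move=> cf; apply/measurable_EFinP; rewrite slab_cut_patch.
apply/(measurable_restrictT _ measurable_slab_dom); apply/measurable_EFinP.
exact: measurable_slab.
Qed.

Lemma slab_cut_bounded f B : continuous_pos f -> vanishes_off B f ->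
  exists M, forall z, `|slab_cut f z| <= M.
Proof.
move=> cf fB; have [M HM] := continuous_pos_bounded B cf.
exists (Num.max M 0) => z; rewrite /slab_cut; case: ifPn => [/andP[h1 h2]|_]; last first.
  by rewrite normr0 le_max lexx orbT.
have [zB|] := pselect (forall j, `|(space_time_point z).1 ord0 j| <= B).
  by rewrite le_max HM// !ltW.
move=> /existsNP[j /negP]; rewrite -ltNge => zB.
by rewrite fB; [rewrite normr0 le_max lexx orbT|exists j].
Qed.

Lemma slab_cut_box f B z : vanishes_off B f ->
  ~ (tuple_box n B `*` `[Tm, Tp]) z -> slab_cut f z = 0.
Proof.
move=> fB nz; rewrite /slab_cut; case: ifPn => // /andP[h1 h2]; apply: fB.
apply/not_existsP => H; apply: nz; split => /=; last by rewrite in_itv/= !ltW.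
move=> j; rewrite /= in_itv /= -ler_norml leNgt; apply/negP => h.
by apply: (H j); rewrite mxE.
Qed.

Lemma slab_box_lty B : (@product_measure1 _ _ (n.-tuple RR) RR R (lebesgue_tuple n)
   lebesgue_measure (tuple_box n B `*` `[Tm, Tp]%classic) < +oo)%E.
Proof.
have H1 := lebesgue_tuple_box_lty n B.
have H2 : (lebesgue_measure (`[Tm, Tp]%classic : set RR) < +oo)%E.
  by rewrite lebesgue_measure_itv/=; case: ifPn => // _; rewrite -EFinB ltry.
rewrite product_measure1E; [|exact: measurable_tuple_box|exact: measurable_itv].
by rewrite lte_mul_pinfty// ge0_fin_numE.
Qed.

Lemma slab_cut_integrable f B : continuous_pos f -> vanishes_off B f ->
  (lebesgue_tuple n \x lebesgue_measure)%E.-integrable setT (EFin \o slab_cut f).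
Proof.
move=> cf fB; have [M HM] := slab_cut_bounded cf fB.
apply: (@bounded_support_integrable _ (n.-tuple RR * RR)%type R _
   (tuple_box n B `*` (`[Tm, Tp]%classic : set RR)) (slab_cut f) M) => //.
- by apply: measurableX; [exact: measurable_tuple_box|exact: measurable_itv].
- exact: slab_box_lty.
- exact: measurable_slab_cut.
- by move=> z; exact: slab_cut_box.
Qed.

Lemma slab_integrable f B : continuous_pos f -> vanishes_off B f ->
  (lebesgue_tuple n \x lebesgue_measure)%E.-integrable slab_dom
    (EFin \o (f \o space_time_point)).
Proof.
move=> cf fB.
rewrite -[slab_dom]setTI; apply/(integrable_restrict _ measurable_slab_dom measurableT).
by have := slab_cut_integrable cf fB; rewrite slab_cut_patch.
Qed.

Lemma row_of_set_tnth (x : n.-tuple RR) i (s : R) :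
  row_of_tuple (set_tnth x i s) =
  row_of_tuple (set_tnth x i 0) + s *: delta_mx ord0 i :> 'rV[R]_n.
Proof.
apply/rowP => j; rewrite !mxE !tnth_mktuple eqxx /=.
by case: eqVneq => _; rewrite ?mulr1 ?add0r// mulr0 addr0.
Qed.

Lemma slab_integral_x_lines0 f B i : continuous_pos f -> vanishes_off B f ->
  (forall z, 0 < z.2 ->
     (\int[lebesgue_measure]_s (f (z + s *: dir_x i))%:E = 0)%E) ->
  slab_integral Tm Tp f = 0%E.
Proof.
move=> cf fB f0; have [M HM] := slab_cut_bounded cf fB.
rewrite slab_integral_cut -(integral21_prod_meas1 (slab_cut_integrable cf fB))/=.
rewrite integral0_eq// => t _; rewrite /fubini_G /=.
apply: (@integral_tuple_lines0 R n (fun x => slab_cut f (x, t)) i B M) => //.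
- apply: measurableT_comp; first exact: measurable_slab_cut.
  exact: pair2_measurable.
- by move=> x nx; apply: (slab_cut_box fB) => -[].
- move=> x; case: (boolP (Tm < t < Tp)) => [tT|ntT]; last first.
    by rewrite integral0_eq// => s _; rewrite /slab_cut /= (negbTE ntT).
  rewrite -[RHS](f0 (row_of_tuple (set_tnth x i 0), t)); last first.
    by case/andP : tT => h _; exact: lt_trans h.
  apply: eq_integral => s _; rewrite /slab_cut /= tT /space_time_point /=.
  rewrite row_of_set_tnth /dir_x; congr ((f _)%:E).
  by rewrite [RHS]surjective_pairing /= scaler0 addr0.
Qed.

Lemma slab_integral_t_lines0 f B : continuous_pos f -> vanishes_off B f ->
  (forall x, (\int[lebesgue_measure]_(t in `]Tm, Tp[) (f (x, t))%:E = 0)%E) ->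
  slab_integral Tm Tp f = 0%E.
Proof.
move=> cf fB f0.
rewrite slab_integral_cut -(integral12_prod_meas1 (slab_cut_integrable cf fB))/=.
rewrite integral0_eq// => x _; rewrite /fubini_F /=.
rewrite -[RHS](f0 (row_of_tuple x)) [RHS]integral_mkcond.
apply: eq_integral => t _; rewrite patchE /slab_cut /=.
rewrite (_ : (t \in _) = (Tm < t < Tp)); first by case: ifP.
by apply/idP/idP => [/set_mem|tT]; [|apply/mem_set]; rewrite /= in_itv.
Qed.

End slab.

(** * Derivatives along lines *)

Section fundamental_theorem.
Context {R : realType}.
Implicit Types f df : R -> R.

Lemma is_derive_continuous f (a x : R) : is_derive x 1 f a -> {for x, continuous f}.
Proof. by move=> [/derivable1_diffP/differentiable_continuous]. Qed.

Lemma integral_oo_derive0 f df (a b : R) : a < b ->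
  (forall s : R, a <= s <= b -> is_derive s 1 f (df s)) ->
  (forall s, a <= s <= b -> {for s, continuous df}) ->
  f a = 0 -> f b = 0 ->
  (\int[lebesgue_measure]_(s in `]a, b[) (df s)%:E = 0)%E.
Proof.
move=> ab fdf cdf fa fb.
have wdf : {within `[a, b], continuous df}.
  by apply: continuous_in_subspaceT => s /set_mem /=; rewrite in_itv/=; exact: cdf.
have [la lb] : a <= a <= b /\ a <= b <= b by rewrite !lexx ltW.
rewrite -(@integral_itv_bndoo _ _ _ _ true false); last first.
  apply/measurable_EFinP; apply: open_continuous_measurable_fun => //.
  by move=> s /set_mem /=; rewrite in_itv/= => /andP[h1 h2]; apply: cdf; rewrite !ltW.
rewrite (@continuous_FTC2 _ _ f) ?fa ?fb ?subee//.
- split.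
  + by move=> s; rewrite in_itv/= => /andP[h1 h2]; apply: ex_derive; apply: fdf; rewrite !ltW.
  + by apply: cvg_at_right_filter; exact: is_derive_continuous (fdf _ la).
  + by apply: cvg_at_left_filter; exact: is_derive_continuous (fdf _ lb).
- move=> s; rewrite in_itv/= => /andP[h1 h2].
  have : is_derive s 1 f (df s) by apply: fdf; rewrite !ltW.
  by rewrite derive1E => -[].
Qed.

Lemma integral_line_derive0 f df (B : R) :
  (forall s : R, is_derive s 1 f (df s)) -> continuous df ->
  (forall s, B < `|s| -> f s = 0) -> (forall s, B < `|s| -> df s = 0) ->
  (\int[lebesgue_measure]_s (df s)%:E = 0)%E.
Proof.
move=> fdf cdf fB dfB; set b := `|B| + 1.
have b0 : 0 < b by rewrite ltr_pwDr.
have Bb : B < b by rewrite (le_lt_trans (ler_norm _))// ltrDl.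
have <- : (\int[lebesgue_measure]_(s in `](- b)%R, b[) (df s)%:E = 0)%E.
  apply: (@integral_oo_derive0 f df (- b) b).
  - by lra.
  - by move=> s _; exact: cdf.
  - by rewrite fB// normrN gtr0_norm.
  - by rewrite fB// gtr0_norm.
rewrite [RHS]integral_mkcond; apply: eq_integral => s _; rewrite patchE.
case: ifPn => // /negP; rewrite inE /= in_itv/= -ltr_norml => /negP.
by rewrite -leNgt => bs; rewrite dfB// (lt_le_trans Bb).
Qed.

End fundamental_theorem.

Section lines.
Context {R : realType} {V : normedModType R}.
Implicit Types (f : V -> R) (z v w : V).

Lemma is_derive_line f z v s : derivable f (z + s *: v) v ->
  is_derive s 1 (fun r : R => f (z + r *: v)) ('D_v f (z + s *: v)).
Proof.
move=> df; have E : (fun h : R => h^-1 *: (f (z + (h *: (1 : R) + s) *: v) - f (z + s *: v)))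
   = (fun h => h^-1 *: (f (h *: v + (z + s *: v)) - f (z + s *: v))).
  apply/funext => h; have -> : h *: (1 : R) = h by exact: mulr1.
  by rewrite scalerDl addrCA.
by split; rewrite /derivable /derive /= E.
Qed.

Lemma continuous_line z v : continuous (fun r : R => z + r *: v).
Proof.
move=> r; apply: cvgD; first exact: cvg_cst.
exact: scalel_continuous.
Qed.

Lemma mvt_line f z v (s : R) : 0 < s -> (forall y, derivable f y v) ->
  exists2 r, 0 <= r <= s & f (z + s *: v) - f z = s * 'D_v f (z + r *: v).
Proof.
move=> s0 df.
have fd r := is_derive_line (df (z + r *: v)).
have [|r] := @MVT _ (fun r => f (z + r *: v)) (fun r => 'D_v f (z + r *: v)) 0 s s0
    (fun r _ => fd r).
  by apply: continuous_subspaceT => r; exact: is_derive_continuous (fd r).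
rewrite in_itv/= => /andP[r0 rs] E; exists r; first by rewrite !ltW.
by move: E; rewrite scale0r addr0 subr0 mulrC.
Qed.

(** The mean value theorem twice: along [v] for the difference of [f] in the
    direction [w], then along [w] for the derivative found. The left-hand side is
    symmetric in [v] and [w], which is what makes mixed derivatives agree. *)
Lemma second_difference f z v w (s : R) : 0 < s ->
  (forall y, derivable f y v) -> (forall y, derivable ('D_v f) y w) ->
  exists r q, [/\ 0 <= r <= s, 0 <= q <= s &
    f (z + s *: v + s *: w) - f (z + s *: v) - f (z + s *: w) + f z =
    s ^+ 2 * 'D_w ('D_v f) (z + r *: v + q *: w)].
Proof.
move=> s0 dv dw.
pose g y := f (y + s *: w) - f y.
have shift y : derivable (fun y => f (y + s *: w)) y v /\
    'D_v (fun y => f (y + s *: w)) y = 'D_v f (y + s *: w).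
  have E : (fun h : R => h^-1 *: (f (h *: v + y + s *: w) - f (y + s *: w))) =
    (fun h : R => h^-1 *: (f (h *: v + (y + s *: w)) - f (y + s *: w))).
    by apply/funext => h; rewrite addrA.
  split; last by rewrite /derive E.
  by have := dv (y + s *: w); rewrite /derivable E.
have dg y : derivable g y v by apply: derivableB => //; exact: (shift y).1.
have [r rs Er] := @mvt_line g z v s s0 dg.
have [q qs Eq] := @mvt_line ('D_v f) (z + r *: v) w s s0 dw.
exists r, q; split => //.
rewrite expr2 -mulrA -Eq -(shift (z + r *: v)).2 -deriveB//; last exact: (shift _).1.
rewrite -[X in s * X]/('D_v g (z + r *: v)) -Er /g addrAC opprB; ring.
Qed.

Lemma dist_triangle_half (A B C e : R) :
  `|A - B| < e / 2 -> `|C - B| < e / 2 -> `|A - C| <= e.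
Proof.
move=> AB CB; rewrite (splitr e) -(subrKA B A (- C)).
by apply: (le_trans (ler_normD _ _)); rewrite (distrC B) lerD// ltW.
Qed.

(** Both mixed derivatives take, near [z], a common value: the second difference
    over [s ^+ 2]. Continuity at [z] does the rest. *)
Lemma derive_comm f z v w :
  (forall y, derivable f y v) -> (forall y, derivable f y w) ->
  (forall y, derivable ('D_v f) y w) -> (forall y, derivable ('D_w f) y v) ->
  {for z, continuous ('D_w ('D_v f))} -> {for z, continuous ('D_v ('D_w f))} ->
  'D_w ('D_v f) z = 'D_v ('D_w f) z.
Proof.
move=> dv dw dvw dwv cvw cwv.
apply/eqP; rewrite -subr_eq0 -normr_eq0 eq_le normr_ge0 andbT.
apply/ler_addgt0Pr => e e0; rewrite add0r.
have e20 : 0 < e / 2 by rewrite divr_gt0.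
have /cvgrPdist_lt /(_ _ e20) /nbhs_normP [d1 /= d10 Hd1] := cvw.
have /cvgrPdist_lt /(_ _ e20) /nbhs_normP [d2 /= d20 Hd2] := cwv.
set d := Num.min d1 d2; have d0 : 0 < d by rewrite lt_min d10.
set N := `|v| + `|w| + 1; have N0 : 0 < N by rewrite ltr_pwDr// addr_ge0.
have [s s0 sN] : exists2 s : R, 0 < s & s * N < d.
  exists (d / N / 2); first by rewrite !divr_gt0.
  by rewrite mulrAC divfK ?gt_eqF// ltr_pdivrMr//; lra.
have close r q : 0 <= r <= s -> 0 <= q <= s -> `|z - (z + r *: v + q *: w)| < d.
  move=> /andP[r0 rs] /andP[q0 qs].
  rewrite -addrA opprD addrA subrr sub0r normrN.
  apply: (@le_lt_trans _ _ (s * N)) => //.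
  apply: (le_trans (ler_normD _ _)); rewrite !normrZ !ger0_norm// !mulrDr mulr1.
  rewrite -[leLHS]addr0; apply: lerD; last exact: ltW.
  by apply: lerD; exact: ler_wpM2r.
have [r1 [q1 [hr1 hq1 E1]]] := @second_difference f z v w s s0 dv dvw.
have [r2 [q2 [hr2 hq2 E2]]] := @second_difference f z w v s s0 dw dwv.
have /Hd1 h1 : ball_ Num.Def.normr z d1 (z + r1 *: v + q1 *: w).
  by apply: lt_le_trans (close _ _ hr1 hq1) _; rewrite ge_min lexx.
have /Hd2 h2 : ball_ Num.Def.normr z d2 (z + r2 *: w + q2 *: v).
  rewrite addrAC.
  by apply: lt_le_trans (close _ _ hq2 hr2) _; rewrite ge_min lexx orbT.
have E : 'D_w ('D_v f) (z + r1 *: v + q1 *: w) = 'D_v ('D_w f) (z + r2 *: w + q2 *: v).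
  have s20 : s ^+ 2 != 0 by rewrite expf_neq0// gt_eqF.
  apply: (mulfI s20); apply: etrans (esym E1) (etrans _ E2).
  by rewrite (addrAC z); congr (_ + _); exact: addrAC.
rewrite /= E in h1.
exact: dist_triangle_half h1 h2.
Qed.

Lemma smooth_continuous f : smooth f -> continuous f.
Proof. exact: (fun sf => sf 0%N). Qed.

Lemma smooth_derivable f : smooth f -> forall v z, derivable f z v.
Proof. by move=> sf v; exact: (sf 1%N v).1. Qed.

Lemma smooth_derive f : smooth f -> forall v, smooth ('D_v f).
Proof. by move=> sf v k; exact: (sf k.+1 v).2. Qed.

Lemma smooth_derive_comm f : smooth f -> forall v w, 'D_w ('D_v f) = 'D_v ('D_w f).
Proof.
move=> sf v w; apply/funext => z.
have dsf x := smooth_derive sf x.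
apply: derive_comm; try exact: smooth_derivable.
- exact/smooth_continuous/smooth_derive.
- exact/smooth_continuous/smooth_derive.
Qed.

Lemma derive_off_closed f (K : set V) v : closed K ->
  (forall z, ~ K z -> f z = 0) -> forall z, ~ K z -> 'D_v f z = 0.
Proof.
move=> cK fK z nKz; rewrite -(derive_cst (0 : R) z v).
apply: near_eq_derive; have : nbhs z (~` K) by exact: open_nbhs_nbhs (conj (closed_openC cK) nKz).
by apply: filterS => y /fK ->.
Qed.

Lemma off_tsupport f z : ~ tsupport f z -> f z = 0.
Proof.
by move=> nz; apply: contrapT => /eqP fz; apply: nz; exact: subset_closure.
Qed.

End lines.

(** * Derivatives integrate to zero over the slab *)

Section continuous_pos_closure.
Context {R : realType} {n : nat}.
Implicit Types f g : 'rV[R]_n * R -> R.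

Lemma continuous_pos_continuous f : continuous f -> continuous_pos f.
Proof. by move=> cf z _; exact: cf. Qed.

Lemma continuous_pos_cst (c : R) : continuous_pos (fun _ : 'rV[R]_n * R => c).
Proof. by move=> z _; exact: cvg_cst. Qed.

Lemma continuous_posD f g : continuous_pos f -> continuous_pos g ->
  continuous_pos (fun z => f z + g z).
Proof. by move=> cf cg z z0; exact: cvgD (cf z z0) (cg z z0). Qed.

Lemma continuous_posN f : continuous_pos f -> continuous_pos (fun z => - f z).
Proof. by move=> cf z z0; exact: cvgN (cf z z0). Qed.

Lemma continuous_posB f g : continuous_pos f -> continuous_pos g ->
  continuous_pos (fun z => f z - g z).
Proof. by move=> cf cg z z0; exact: cvgB (cf z z0) (cg z z0). Qed.

Lemma continuous_posM f g : continuous_pos f -> continuous_pos g ->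
  continuous_pos (fun z => f z * g z).
Proof. by move=> cf cg z z0; exact: cvgM (cf z z0) (cg z z0). Qed.

Lemma continuous_posX f m : continuous_pos f -> continuous_pos (fun z => f z ^+ m).
Proof.
move=> cf; elim: m => [|m IH]; first exact: continuous_pos_cst.
under [X in continuous_pos X]eq_fun do rewrite exprS.
exact: continuous_posM.
Qed.

Lemma continuous_pos_sum m (f : 'I_m -> 'rV[R]_n * R -> R) :
  (forall i, continuous_pos (f i)) -> continuous_pos (fun z => \sum_(i < m) f i z).
Proof.
move=> cf; rewrite (_ : (fun z => _) = \sum_(i < m) f i); last first.
  by apply/funext => z; rewrite fct_sumE.
apply: big_ind => //; first exact: continuous_pos_cst.
by move=> f1 f2; exact: continuous_posD.
Qed.

Lemma continuous_pos_time (P : R -> R) : (forall t, 0 < t -> {for t, continuous P}) ->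
  continuous_pos (fun z : 'rV[R]_n * R => P z.2).
Proof. by move=> cP z z0; apply: (cvg_comp snd P); [exact: cvg_snd|exact: cP]. Qed.

Lemma continuous_pos_space (W : 'rV[R]_n -> R) : continuous W ->
  continuous_pos (fun z : 'rV[R]_n * R => W z.1).
Proof. by move=> cW z z0; apply: (cvg_comp fst W); [exact: cvg_fst|exact: cW]. Qed.

End continuous_pos_closure.

Section slab_divergence.
Context {R : realType} (n : nat) (Tm Tp : R).
Hypothesis (Tm0 : 0 < Tm) (TmTp : Tm < Tp).
Implicit Types f df : 'rV[R]_n * R -> R.

(** The antiderivative [f] has to vanish far out too: its values at the two ends of
    a long segment are what the fundamental theorem leaves. *)
Lemma slab_integral_dx f df B i : continuous_pos df ->
  vanishes_off B f -> vanishes_off B df ->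
  (forall z (s : R), 0 < z.2 ->
     is_derive s 1 (fun r : R => f (z + r *: dir_x i)) (df (z + s *: dir_x i))) ->
  slab_integral Tm Tp df = 0%E.
Proof.
move=> cdf fB dfB ddf; apply: (@slab_integral_x_lines0 R n Tm Tp Tm0 df B i cdf dfB) => z z0.
have off (s : R) : B + `|z.1 ord0 i| < `|s| ->
    exists j, B < `|(z + s *: dir_x i).1 ord0 j|.
  move=> Bs; exists i; rewrite /= !mxE !eqxx mulr1.
  have := lerB_normD s (z.1 ord0 i); rewrite [s + _]addrC; lra.
apply: (@integral_line_derive0 _ (fun s => f (z + s *: dir_x i))
          (fun s => df (z + s *: dir_x i)) (B + `|z.1 ord0 i|)).
- by move=> s; exact: ddf.
- move=> s; apply: (cvg_comp (fun s => z + s *: dir_x i) df).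
    exact: (@continuous_line _ _ z (dir_x i) s).
  by apply: cdf; rewrite /= scaler0 addr0.
- by move=> s /off; exact: fB.
- by move=> s /off; exact: dfB.
Qed.

Lemma slab_integral_dt f df B : continuous_pos df -> vanishes_off B df ->
  (forall x (t : R), 0 < t -> is_derive t 1 (fun r : R => f (x, r)) (df (x, t))) ->
  (forall x, f (x, Tm) = 0) -> (forall x, f (x, Tp) = 0) ->
  slab_integral Tm Tp df = 0%E.
Proof.
move=> cdf dfB ddf fm fp; apply: (@slab_integral_t_lines0 R n Tm Tp Tm0 df B cdf dfB) => x.
have pos t : Tm <= t <= Tp -> 0 < t by move=> /andP[h _]; exact: lt_le_trans h.
apply: (@integral_oo_derive0 _ (fun t => f (x, t)) (fun t => df (x, t))) => //.
- by move=> t /pos; exact: ddf.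
- move=> t /pos t0; apply: (cvg_comp (fun s => (x, s)) df); last exact: cdf.
  apply: (@cvg_pair _ _ _ (nbhs t) (nbhs x) (nbhs t) _ _ _ (fun=> x) id).
    exact: cvg_cst.
  exact: cvg_id.
Qed.

Lemma slab_integral0D B f g : continuous_pos f -> continuous_pos g ->
  vanishes_off B f -> vanishes_off B g ->
  slab_integral Tm Tp f = 0%E -> slab_integral Tm Tp g = 0%E ->
  slab_integral Tm Tp (fun z => f z + g z) = 0%E.
Proof.
move=> cf cg fB gB If Ig; rewrite /slab_integral.
under eq_integral do rewrite EFinD.
rewrite integralD_EFin//=; [| exact: measurable_slab_dom | |].
- by rewrite [X in (X + _)%E]If [X in (_ + X)%E]Ig adde0.
- exact: (slab_integrable Tp Tm0 cf fB).
- exact: (slab_integrable Tp Tm0 cg gB).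
Qed.

Lemma slab_integral0_sum B m (f : 'I_m -> 'rV[R]_n * R -> R) :
  (forall i, continuous_pos (f i)) -> (forall i, vanishes_off B (f i)) ->
  (forall i, slab_integral Tm Tp (f i) = 0%E) ->
  slab_integral Tm Tp (fun z => \sum_(i < m) f i z) = 0%E.
Proof.
move=> cf fB If; rewrite (_ : (fun z => _) = \sum_(i < m) f i); last first.
  by apply/funext => z; rewrite fct_sumE.
suff [] : [/\ continuous_pos (\sum_(i < m) f i), vanishes_off B (\sum_(i < m) f i) &
  slab_integral Tm Tp (\sum_(i < m) f i) = 0%E] by [].
apply: (big_ind (fun g => [/\ continuous_pos g, vanishes_off B g &
    slab_integral Tm Tp g = 0%E])) => //.
- split=> //; first exact: continuous_pos_cst.
  by rewrite /slab_integral integral0_eq.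
- move=> g1 g2 [c1 v1 i1] [c2 v2 i2]; split.
  + exact: continuous_posD.
  + by move=> z zB; exact: etrans (congr2 +%R (v1 z zB) (v2 z zB)) (addr0 0).
  + exact: slab_integral0D c1 c2 v1 v2 i1 i2.
Qed.

End slab_divergence.

(** The form in which the pointwise inequality is integrated: an error term [e]
    of arbitrary sign but zero integral may be added to the smaller side. *)
Lemma slab_integral_le (R : realType) (n : nat) (Tm Tp : R) (Tm0 : 0 < Tm)
    (f g e : 'rV[R]_n * R -> R) (B C : R) :
  continuous_pos f -> continuous_pos g -> continuous_pos e ->
  vanishes_off B f -> vanishes_off B g -> vanishes_off B e ->
  (forall z, Tm < z.2 < Tp -> f z + e z <= C * g z) ->
  slab_integral Tm Tp e = 0%E ->
  (slab_integral Tm Tp f <= C%:E * slab_integral Tm Tp g)%E.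
Proof.
move=> cf cg ce fB gB eB feg Ie.
have If := slab_integrable Tp Tm0 cf fB.
have Ig := slab_integrable Tp Tm0 cg gB.
have Iie := slab_integrable Tp Tm0 ce eB.
have mD := @measurable_slab_dom R n Tm Tp.
rewrite -[leLHS]adde0 -Ie /slab_integral -/(@slab_dom R n Tm Tp).
rewrite -(integralZl mD Ig) -(integralD_EFin mD If Iie).
apply: le_integral => //; [exact: integrableD|exact: integrableZl|].
move=> z /set_mem [_ /=]; rewrite in_itv/= => zT.
by rewrite -EFinD -EFinM lee_fin; exact: (feg (space_time_point z)).
Qed.

(** * The Carleman identity *)

Section pointwise_derivation.
Context {R : realType}.
Implicit Types (f g : R -> R) (s a b : R).

Lemma is_derive_cstM c f s a : is_derive s 1 f a ->
  is_derive s 1 (fun r => c * f r) (c * a).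
Proof. by move=> df; exact: (@is_deriveZ _ _ _ f c s 1 a df). Qed.

Lemma is_derive_mul f g s a b : is_derive s 1 f a -> is_derive s 1 g b ->
  is_derive s 1 (fun r => f r * g r) (a * g s + f s * b).
Proof.
move=> df dg; rewrite addrC [a * _]mulrC.
exact: (@is_deriveM _ _ f g s 1 a b df dg).
Qed.

Lemma is_derive_add f g s a b : is_derive s 1 f a -> is_derive s 1 g b ->
  is_derive s 1 (fun r => f r + g r) (a + b).
Proof. by move=> df dg; exact: (@is_deriveD _ _ _ f g s 1 a b df dg). Qed.

Lemma is_derive_sub f g s a b : is_derive s 1 f a -> is_derive s 1 g b ->
  is_derive s 1 (fun r => f r - g r) (a - b).
Proof. by move=> df dg; exact: (@is_deriveB _ _ _ f g s 1 a b df dg). Qed.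

Lemma is_derive_sqr f s a : is_derive s 1 f a ->
  is_derive s 1 (fun r => f r ^+ 2) (2 * f s * a).
Proof.
move=> df; have := is_derive_mul df df.
rewrite (_ : a * f s + f s * a = 2 * f s * a); last by ring.
by under eq_fun do rewrite -expr2.
Qed.

Lemma is_derive_sum_fun m (f : 'I_m -> R -> R) (a : 'I_m -> R) s :
  (forall i, is_derive s 1 (f i) (a i)) ->
  is_derive s 1 (fun r => \sum_(i < m) f i r) (\sum_(i < m) a i).
Proof.
move=> df; have := @is_derive_sum _ _ _ m f s 1 a df.
by rewrite (_ : \sum_(i < m) f i = fun r => \sum_(i < m) f i r)//;
  apply/funext => r; rewrite fct_sumE.
Qed.

End pointwise_derivation.

Section space_time_lines.
Context {R : realType} {n : nat}.

Lemma line_x_snd (z : 'rV[R]_n * R) (r : R) i : (z + r *: dir_x i).2 = z.2.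
Proof. by rewrite /= scaler0 addr0. Qed.

Lemma is_derive_x (f : 'rV[R]_n * R -> R) z i (s : R) : smooth f ->
  is_derive s 1 (fun r : R => f (z + r *: dir_x i)) ('D_(dir_x i) f (z + s *: dir_x i)).
Proof. by move=> sf; apply: is_derive_line; exact: smooth_derivable. Qed.

Lemma is_derive_t (f : 'rV[R]_n * R -> R) (x : 'rV[R]_n) (t : R) : smooth f ->
  is_derive t 1 (fun r : R => f (x, r)) ('D_(@dir_t R n) f (x, t)).
Proof.
move=> sf; have E (r : R) : (x, r) = (x, 0) + r *: (@dir_t R n) :> 'rV[R]_n * R.
  rewrite [RHS]surjective_pairing /= scaler0 addr0 add0r.
  by congr (_, _); exact: (esym (mulr1 r)).
rewrite E (_ : (fun r => f (x, r)) = fun r => f ((x, 0) + r *: (@dir_t R n))).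
  by apply: is_derive_line; exact: smooth_derivable.
by apply/funext => r; rewrite E.
Qed.

End space_time_lines.

Section test_function.
Context {R : realType} (n : nat) (Tm Tp : R) (u : 'rV[R]_n * R -> R).
Hypothesis testu : test_function Tm Tp u.

Lemma test_function_box : exists B : R, forall z : 'rV[R]_n * R,
  (exists j, B < `|z.1 ord0 j|) ->
  ~ tsupport u z.
Proof.
case: testu => _ /compact_bounded [M [_ HM]] _; exists (M + 1) => z [j Bz] /HM.
move=> /(_ (M + 1)); rewrite ltrDl ltr01 => /(_ isT) zM.
have : `|z.1 ord0 j| <= M + 1.
  apply: le_trans zM; apply: (@le_trans _ _ `|z.1|); last by rewrite prod_normE le_max lexx.
  rewrite [leRHS]/Num.norm /= mx_normrE.
  exact: (le_bigmax _ (fun ij => `|z.1 ij.1 ij.2|) (ord0, j)).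
by rewrite leNgt Bz.
Qed.

Lemma test_function_ends x : ~ tsupport u (x, Tm) /\ ~ tsupport u (x, Tp).
Proof.
by case: testu => _ _ sub; split => /sub [_ /=]; rewrite in_itv/= ltxx ?andbF.
Qed.

End test_function.

(** The weights enter through their logarithmic derivatives alone: [P] has
    [- 2 Q] in time, and [W] has [b i] in the i-th space variable. The function
    [H] stands for 1/h and is not differentiated. *)
Section carleman_identity.
Context {R : realType} (n : nat) (Tm Tp : R) (u : 'rV[R]_n * R -> R).
Hypotheses (Tm0 : 0 < Tm) (TmTp : Tm < Tp) (testu : test_function Tm Tp u).

Variables (P Q Q' H : R -> R) (W : 'rV[R]_n -> R) (b : 'I_n -> 'rV[R]_n -> R).
Hypotheses
  (dP : forall t : R, 0 < t -> is_derive t 1 P (- (2 * Q t * P t)))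
  (dQ : forall t : R, 0 < t -> is_derive t 1 Q (Q' t))
  (cQ' : forall t, 0 < t -> {for t, continuous Q'})
  (cH : forall t, 0 < t -> {for t, continuous H})
  (cW : continuous W) (cb : forall i, continuous (b i))
  (dW : forall (x : 'rV[R]_n) i (s : R),
     is_derive s 1 (fun r : R => W (x + r *: delta_mx ord0 i))
       (b i (x + s *: delta_mx ord0 i) * W (x + s *: delta_mx ord0 i))).

(** This is [W^-1 div (W grad u)]. *)
Definition drift_laplacian (z : 'rV[R]_n * R) : R :=
  laplacian_x u z + \sum_(i < n) b i z.1 * 'D_(dir_x i) u z.

Local Notation D i f := ('D_(dir_x i) f).
Let smu : smooth u. Proof. by case: testu. Qed.
Let smD v : smooth ('D_v u). Proof. exact: smooth_derive. Qed.

Let u0 z : ~ tsupport u z -> u z = 0. Proof. exact: off_tsupport. Qed.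
Let cK : closed (tsupport u). Proof. exact: closed_closure. Qed.
Let Du0 v z : ~ tsupport u z -> 'D_v u z = 0.
Proof. by apply: derive_off_closed => //; exact: cK. Qed.
Let DDu0 v w z : ~ tsupport u z -> 'D_w ('D_v u) z = 0.
Proof. by apply: derive_off_closed; [exact: cK|exact: Du0]. Qed.

Let cu : continuous_pos u.
Proof. exact/continuous_pos_continuous/smooth_continuous. Qed.
Let cDu v : continuous_pos ('D_v u).
Proof. exact/continuous_pos_continuous/smooth_continuous. Qed.
Let cDDu v w : continuous_pos ('D_w ('D_v u)).
Proof. exact/continuous_pos_continuous/smooth_continuous/smooth_derive. Qed.
Let cPz : continuous_pos (fun z : 'rV[R]_n * R => P z.2).
Proof. by apply: continuous_pos_time => t /dP; exact: is_derive_continuous. Qed.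
Let cQz : continuous_pos (fun z : 'rV[R]_n * R => Q z.2).
Proof. by apply: continuous_pos_time => t /dQ; exact: is_derive_continuous. Qed.
Let cQ'z : continuous_pos (fun z : 'rV[R]_n * R => Q' z.2).
Proof. exact: continuous_pos_time. Qed.
Let cHz : continuous_pos (fun z : 'rV[R]_n * R => H z.2).
Proof. exact: continuous_pos_time. Qed.
Let cWz : continuous_pos (fun z : 'rV[R]_n * R => W z.1).
Proof. exact: continuous_pos_space. Qed.
Let cbz i : continuous_pos (fun z : 'rV[R]_n * R => b i z.1).
Proof. by apply: continuous_pos_space; exact: cb. Qed.

Implicit Types z : 'rV[R]_n * R.

Ltac continuous_pos_tac :=
  cbv beta;
  lazymatch goal with
  | |- continuous_pos (fun z => @?f z - @?g z) =>
      apply: (@continuous_posB _ _ f g); continuous_pos_tac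
  | |- continuous_pos (fun z => @?f z + @?g z) =>
      apply: (@continuous_posD _ _ f g); continuous_pos_tac
  | |- continuous_pos (fun z => - @?f z) =>
      apply: (@continuous_posN _ _ f); continuous_pos_tac
  | |- continuous_pos (fun z => @?f z * @?g z) =>
      apply: (@continuous_posM _ _ f g); continuous_pos_tac
  | |- continuous_pos (fun z => @?f z ^+ ?k) =>
      apply: (@continuous_posX _ _ f k); continuous_pos_tac
  | |- continuous_pos (fun z => \sum_(i < _) @?f z i) =>
      refine (@continuous_pos_sum _ _ _ (fun i z => f z i) _) => ?; continuous_pos_tac
  | |- continuous_pos (fun z => P z.2) => exact: cPz
  | |- continuous_pos (fun z => Q z.2) => exact: cQz
  | |- continuous_pos (fun z => Q' z.2) => exact: cQ'z
  | |- continuous_pos (fun z => H z.2) => exact: cHz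
  | |- continuous_pos (fun z => W z.1) => exact: cWz
  | |- continuous_pos (fun z => b _ z.1) => exact: cbz
  | |- continuous_pos (fun z => dt ('D_?v u) z) => exact: (@cDDu v (@dir_t R n))
  | |- continuous_pos (fun z => dt u z) => exact: (@cDu (@dir_t R n))
  | |- continuous_pos (fun z => 'D_?w ('D_?v u) z) => exact: (@cDDu v w)
  | |- continuous_pos (fun z => 'D_?v u z) => exact: (@cDu v)
  | |- continuous_pos (fun z => u z) => exact: cu
  | |- continuous_pos (fun _ => ?c) => exact: continuous_pos_cst
  end.

(* The field [G] and the function [J] are the antiderivatives: both integrations
   by parts in space have grad u as a factor, and [m] is the sum of their
   coefficients, 16 (u_t - q u) from the cross term and -2 u / h from the gradient
   term. *)
Let m z : R := 16 * (dt u z - Q z.2 * u z) - 2 * (H z.2 * u z).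
Let dm (i : 'I_n) z : R := 16 * (D i ('D_(@dir_t R n) u) z - Q z.2 * D i u z) - 2 * (H z.2 * D i u z).

Let G i z : R := P z.2 * (W z.1 * (m z * D i u z)).
Let dG i z : R := P z.2 * ((b i z.1 * W z.1) * (m z * D i u z) +
  W z.1 * (dm i z * D i u z + m z * D i (D i u) z)).

Let J z : R := 8 * (W z.1 * (P z.2 * (Q z.2 * u z ^+ 2 - \sum_(i < n) D i u z ^+ 2))).
Let dJ z : R := 8 * (W z.1 *
  (- (2 * Q z.2 * P z.2) * (Q z.2 * u z ^+ 2 - \sum_(i < n) D i u z ^+ 2) +
   P z.2 * (Q' z.2 * u z ^+ 2 + Q z.2 * (2 * u z * dt u z) -
            \sum_(i < n) 2 * D i u z * dt (D i u) z))).

Let cdG i : continuous_pos (dG i). Proof. by rewrite /dG /dm /m; continuous_pos_tac. Qed.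
Let cdJ : continuous_pos dJ. Proof. by rewrite /dJ; continuous_pos_tac. Qed.

Let dG0 i z : ~ tsupport u z -> dG i z = 0.
Proof. by move=> nz; rewrite /dG !DDu0// !Du0// !(mulr0, addr0). Qed.

Let dJ0 z : ~ tsupport u z -> dJ z = 0.
Proof.
move=> nz; rewrite /dJ u0// big1 => [|i _]; last by rewrite Du0// expr0n.
rewrite big1 => [|i _]; last by rewrite Du0// mulr0 mul0r.
by rewrite expr0n /= !(mulr0, mul0r) !subr0 !(mulr0, addr0).
Qed.

Let slab_dG i : slab_integral Tm Tp (dG i) = 0%E.
Proof.
have [B HB] := (test_function_box testu).
apply: (@slab_integral_dx _ _ _ _ Tm0 (G i) (dG i) B i) => //.
- by move=> z /HB nz; rewrite /G Du0// !mulr0.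
- by move=> z /HB; exact: dG0.
- move=> z s z0; rewrite /G /dG /m /dm.
  under eq_fun do rewrite !line_x_snd.
  rewrite !line_x_snd; apply: is_derive_cstM; apply: is_derive_mul.
  apply: is_derive_mul; last by apply: is_derive_x; exact: smD.
  apply: is_derive_sub; apply: is_derive_cstM.
    apply: is_derive_sub; first by apply: is_derive_x; exact: smD.
    by apply: is_derive_cstM; apply: is_derive_x; exact: smu.
  by apply: is_derive_cstM; apply: is_derive_x; exact: smu.
Qed.

Let slab_dJ : slab_integral Tm Tp dJ = 0%E.
Proof.
have [B HB] := (test_function_box testu).
have J0 x t : ~ tsupport u (x, t) -> J (x, t) = 0.
  move=> nz; rewrite /J u0//= big1 => [|i _]; last by rewrite Du0// expr0n.
  by rewrite expr0n /= mulr0 subr0 !mulr0.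
apply: (@slab_integral_dt _ _ _ _ Tm0 TmTp J dJ B).
- exact: cdJ.
- by move=> z /HB; exact: dJ0.
- move=> x t t0; rewrite /J /dJ /=; apply: is_derive_cstM; apply: is_derive_cstM.
  apply: is_derive_mul; first exact: dP.
  apply: is_derive_sub.
    apply: is_derive_mul; first exact: dQ.
    by apply: is_derive_sqr; exact: is_derive_t.
  apply: is_derive_sum_fun => i.
  by apply: is_derive_sqr; exact: is_derive_t.
- by move=> x; apply: J0; exact: (test_function_ends testu x).1.
- by move=> x; apply: J0; exact: (test_function_ends testu x).2.
Qed.

(** The first summand is 8 times the defect in the cross term identity, the second
    is -2 times the defect in the gradient identity. The factors 8 and 2 are those
    with which the two identities are used in [carleman_pointwise]. *)
Definition carleman_density z : R := P z.2 * W z.1 *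
  (8 * (2 * (drift_laplacian z + Q z.2 * u z) * (dt u z - Q z.2 * u z)
        + Q' z.2 * u z ^+ 2)
   - 2 * H z.2 * (sqnorm (grad_x u z) + u z * drift_laplacian z)).

(* In the sum of the derivatives of [G i], the mixed derivatives u_{t i} u_i
   occur; they cancel those coming from d_t |grad u|^2 in [dJ]. *)
Let carleman_density_div : carleman_density = fun z => \sum_(i < n) dG i z + dJ z.
Proof.
apply/funext => z; rewrite /carleman_density; apply/esym.
set E := \sum_(i < n) b i z.1 * D i u z.
set L := laplacian_x u z.
set S := \sum_(i < n) D i u z ^+ 2.
pose X := \sum_(i < n) D i ('D_(@dir_t R n) u) z * D i u z.
have -> : drift_laplacian z = L + E by [].
have -> : sqnorm (grad_x u z) = S by apply: eq_bigr => i _; rewrite mxE.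
have -> : \sum_(i < n) dG i z =
    P z.2 * W z.1 * (m z * (L + E) + 16 * X - (16 * Q z.2 + 2 * H z.2) * S).
  pose c := P z.2 * W z.1.
  transitivity (\sum_(i < n) (c * m z * D i (D i u) z + c * m z * (b i z.1 * D i u z) +
      c * 16 * (D i ('D_(@dir_t R n) u) z * D i u z) -
      c * (16 * Q z.2 + 2 * H z.2) * D i u z ^+ 2)).
    apply: eq_bigr => i _; rewrite /dG /dm /c.
    move: (D i (D i u) z) (D i ('D_(@dir_t R n) u) z) (D i u z) (b i z.1) (m z).
    by move: (P z.2) (W z.1) (Q z.2) (H z.2) => *; ring.
  rewrite sumrB !big_split /= -!mulr_sumr -/E -/S -/X -/(laplacian_x u z) -/L /c.
  by ring.
have -> : dJ z = 8 * (W z.1 * (- (2 * Q z.2 * P z.2) * (Q z.2 * u z ^+ 2 - S) +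
   P z.2 * (Q' z.2 * u z ^+ 2 + Q z.2 * (2 * u z * dt u z) - 2 * X))).
  rewrite /dJ /X mulr_sumr -/S (eq_bigr (fun i => 2 * (D i ('D_(@dir_t R n) u) z * D i u z)))//.
  move=> i _; have -> : dt (D i u) z = D i ('D_(@dir_t R n) u) z.
    exact: (congr1 (fun f => f z) (smooth_derive_comm smu (dir_x i) (@dir_t R n))).
  by rewrite mulrAC -!mulrA.
rewrite /m; clearbody E L S X.
move: (P z.2) (W z.1) (Q z.2) (Q' z.2) (H z.2) (u z) (dt u z) => *; ring.
Qed.

Lemma continuous_carleman_density : continuous_pos carleman_density.
Proof.
by rewrite carleman_density_div; apply: continuous_posD => //; exact: continuous_pos_sum.
Qed.

Lemma carleman_density_off_tsupport z : ~ tsupport u z -> carleman_density z = 0.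
Proof.
move=> nz; rewrite carleman_density_div dJ0// addr0 big1// => i _.
exact: dG0.
Qed.

Lemma carleman_identity : slab_integral Tm Tp carleman_density = 0%E.
Proof.
have [B HB] := (test_function_box testu).
have vdG i : vanishes_off B (dG i) by move=> z /HB; exact: dG0.
rewrite carleman_density_div; apply: (@slab_integral0D _ _ _ _ Tm0 B) => //.
- exact: continuous_pos_sum.
- by move=> z zB; rewrite big1// => i _; exact: vdG.
- by move=> z /HB; exact: dJ0.
- exact: slab_integral0_sum cdG vdG slab_dG.
Qed.

End carleman_identity.

(** * The pointwise inequality *)

(** The usual discriminant argument, applied to the sum of the (c v_i - s b_i)^2,
    where s is the inner product; the positive bound [c] stands in for the sum of
    the b_i^2, which may vanish. *)
Lemma cauchy_schwarz_sum (R : realFieldType) n (b v : 'I_n -> R) (c : R) :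
  0 < c -> \sum_(i < n) b i ^+ 2 <= c ->
  (\sum_(i < n) b i * v i) ^+ 2 <= c * \sum_(i < n) v i ^+ 2.
Proof.
move=> c0 bc; set s := \sum_(i < n) b i * v i.
have : 0 <= \sum_(i < n) (c * v i - s * b i) ^+ 2.
  by apply: sumr_ge0 => i _; exact: sqr_ge0.
rewrite (eq_bigr (fun i => c ^+ 2 * v i ^+ 2 - 2 * c * s * (b i * v i) +
  s ^+ 2 * b i ^+ 2)); last by move=> i _; ring.
rewrite big_split /= sumrB -!mulr_sumr -/s => h.
have h2 : s ^+ 2 * \sum_(i < n) b i ^+ 2 <= s ^+ 2 * c by rewrite ler_wpM2l ?sqr_ge0.
rewrite -(ler_pM2l c0); nra.
Qed.

(** With Y = A u + q u, Z = u_t - q u, A u = L + E and D = u_t + L, one has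
    8 (2 Y Z) = 8 (D + E)^2 - 8 Y^2 - 8 Z^2 and 8 (D + E)^2 <= 16 D^2 + 16 E^2.
    The density supplies -8 (a / t^2) u^2 and -2 H S; the first pays for the terms
    in u^2 that come from H (a + 1) u^2, from 2 q H u^2 and, after completing the
    square in -2 H u Y, from H^2 u^2, each at most 2 (a / t^2) u^2; of the second,
    one half is the gradient on the left-hand side and the other half pays for
    16 E^2 <= 16 kappa S. Here [ti] is 1/t. *)
Lemma carleman_pointwise (R : realFieldType) (a ti H q E L S u ut kappa : R) :
  2 <= a -> 2 <= ti -> 0 <= S -> 0 < H -> H <= 2 * ti -> q * H <= a * ti ^+ 2 ->
  16 * kappa <= H -> E ^+ 2 <= kappa * S ->
  H * ((a + 1) * u ^+ 2 + S) +
  (8 * (2 * (L + E + q * u) * (ut - q * u) + - (a * ti ^+ 2) * u ^+ 2)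
   - 2 * H * (S + u * (L + E))) <= 16 * (ut + L) ^+ 2.
Proof.
move=> a2 ti2 S0 H0 Hti qH kH ES.
have [Y HY] : exists Y, Y = L + E + q * u by eexists.
have [Z HZ] : exists Z, Z = ut - q * u by eexists.
have -> : ut = Z + q * u by rewrite HZ; ring.
have -> : L = Y - E - q * u by rewrite HY; ring.
(* The drift term is absorbed by the gradient. *)
have hE : 16 * E ^+ 2 <= H * S.
  by have := ler_wpM2r S0 kH; lra.
have hq : q * H * u ^+ 2 <= a * ti ^+ 2 * u ^+ 2 by rewrite ler_wpM2r// sqr_ge0.
have ati : 2 * ti ^+ 2 <= a * ti ^+ 2 by rewrite ler_wpM2r// sqr_ge0.
have hH2 : H ^+ 2 <= 2 * (a * ti ^+ 2).
  have : H ^+ 2 <= (2 * ti) ^+ 2 by rewrite ler_sqr ?nnegrE//; lra.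
  rewrite exprMn; lra.
have hH : H ^+ 2 * u ^+ 2 <= 2 * (a * ti ^+ 2) * u ^+ 2 by rewrite ler_wpM2r// sqr_ge0.
have ha1 : H * (a + 1) <= 2 * (a * ti ^+ 2).
  have h1 : H * (a + 1) <= (2 * ti) * (a + 1) by rewrite ler_wpM2r//; lra.
  have h2 : ti * (a + 1) <= ti * (2 * a) by rewrite ler_wpM2l; lra.
  have h3 : 0 <= a * (ti * (ti - 2)) by rewrite !mulr_ge0; lra.
  by rewrite expr2; lra.
have ha : H * (a + 1) * u ^+ 2 <= 2 * (a * ti ^+ 2) * u ^+ 2 by rewrite ler_wpM2r// sqr_ge0.
have y2 : 0 <= (Y + H * u) ^+ 2 by exact: sqr_ge0.
have z2 : 0 <= Z ^+ 2 by exact: sqr_ge0.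
have yy : 0 <= Y ^+ 2 by exact: sqr_ge0.
have de : 0 <= (Y + Z - 2 * E) ^+ 2 by exact: sqr_ge0.
have u2 : 0 <= a * ti ^+ 2 * u ^+ 2.
  by rewrite mulr_ge0 ?sqr_ge0// mulr_ge0 ?sqr_ge0//; lra.
clear -hE hq hH ha y2 z2 yy de u2.
lra.
Qed.

(** * The weights *)

Section time_weight.
Context {R : realType}.
Implicit Types (t a : R).

Lemma h_gt0 t : 0 < t -> 0 < h t.
Proof. by move=> t0; rewrite mulr_gt0 ?expR_gt0. Qed.

Lemma is_derive_h t : t != 0 -> is_derive t 1 (@h R) ((1 - t) / t * h t).
Proof.
move=> t0; have dE : is_derive t 1 (fun r : R => expR (- r)) (expR (- t) * (-1)).
  exact: (is_derive1_comp (is_derive_expR (- t)) (is_deriveNid t 1)).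
apply: (is_derive_eq (is_derive_mul (is_derive_id t (1 : R)) dE)).
by rewrite /h; field.
Qed.

Lemma is_derive_h_powR (c t : R) : 0 < t ->
  is_derive t 1 (fun r => h r `^ c) (c * ((1 - t) / t) * h t `^ c).
Proof.
move=> t0; have t0' : t != 0 by rewrite gt_eqF.
apply: (is_derive_eq (is_derive1_comp (is_derive1_powR c (h_gt0 t0)) (is_derive_h t0'))).
have h0 : h t != 0 by rewrite gt_eqF ?h_gt0.
rewrite powRB ?h0 ?implybT// powRr1; last exact/ltW/h_gt0.
by field; rewrite t0' h0.
Qed.

(** The function differentiated is q = a h'/h; the sign of its derivative is what
    makes the commutator positive. *)
Lemma is_derive_dlog_h a t : 0 < t ->
  is_derive t 1 (fun r => a * (r^-1 - 1)) (- (a * t^-1 ^+ 2)).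
Proof.
move=> t0; have t0' : t != 0 by rewrite gt_eqF.
have dV : is_derive t 1 (fun r : R => r^-1) (- t ^- 2 *: (1 : R)).
  exact: (@is_deriveV R id t 1 1 t0' (is_derive_id t (1 : R))).
apply: (is_derive_eq (is_derive_cstM a
  (is_derive_sub dV (is_derive_cst (1 : R) t (1 : R))))).
by rewrite subr0 /GRing.scale /= mulr1 mulrN exprVn.
Qed.

(** All three come from 1 - t <= exp (- t) <= 1. *)
Lemma h_inv_bounds t : 0 < t -> 2 * t <= 1 ->
  [/\ (h t)^-1 <= 2 * t^-1, (t^-1 - 1) * (h t)^-1 <= t^-1 ^+ 2 & t^-1 <= (h t)^-1].
Proof.
move=> t0 t1; have t0' : t != 0 by rewrite gt_eqF.
have e0 : 0 < expR (- t) by exact: expR_gt0.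
have ti0 : 0 < t^-1 by rewrite invr_gt0.
have e1 : 1 - t <= expR (- t) by exact: expR_ge1Dx.
have e2 : expR (- t) <= 1 by rewrite -expR0 ler_expR; lra.
have E : (h t)^-1 = t^-1 * (expR (- t))^-1 by rewrite invfM.
have i1 : 1 <= (expR (- t))^-1 by rewrite invf_ge1.
have i2 : (expR (- t))^-1 <= 2.
  by rewrite -[leRHS]invrK lef_pV2 ?posrE ?invr_gt0//; lra.
have i3 : (1 - t) * (expR (- t))^-1 <= 1 by rewrite ler_pdivrMr// mul1r.
rewrite E; split.
- by rewrite [leRHS]mulrC ler_pM2l.
- rewrite expr2 (_ : _ * _ = t^-1 * t^-1 * ((1 - t) * (expR (- t))^-1)).
    by rewrite -[leRHS]mulr1 ler_pM2l// mulr_gt0.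
  by field; rewrite t0' gt_eqF.
- by rewrite -[leLHS]mulr1 ler_pM2l.
Qed.

End time_weight.

Section space_weight.
Context {R : realType} {n : nat}.
Implicit Types (x : 'rV[R]_n).

Lemma sqnorm_ge0 x : 0 <= sqnorm x.
Proof. by apply: sumr_ge0 => i _; exact: sqr_ge0. Qed.

Lemma continuous_sqnorm : continuous (@sqnorm R n).
Proof.
rewrite (_ : @sqnorm R n = \sum_(i < n) (fun x : 'rV[R]_n => x ord0 i ^+ 2)).
  apply: (big_ind (fun f : 'rV[R]_n -> R => continuous f)).
  - exact: (@cst_continuous _ _ (0 : R)).
  - by move=> f g cf cg x; exact: cvgD (cf x) (cg x).
  - move=> i _ x; apply: (cvg_comp (fun y : 'rV[R]_n => y ord0 i) (fun r => r ^+ 2)).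
      exact: coord_continuous.
    exact: exprn_continuous.
by apply/funext => x; rewrite fct_sumE.
Qed.

Lemma is_derive_sqnorm x i (s : R) :
  is_derive s 1 (fun r : R => sqnorm (x + r *: delta_mx ord0 i))
    (2 * (x + s *: delta_mx ord0 i) ord0 i).
Proof.
have D j : is_derive s 1 (fun r : R => (x + r *: delta_mx ord0 i) ord0 j) ((j == i)%:R : R).
  have := is_derive_add (is_derive_cst (x ord0 j) s (1 : R))
     (is_derive_cstM (j == i)%:R (is_derive_id s (1 : R))).
  rewrite mulr1 add0r.
  by congr is_derive; apply/funext => r; rewrite !mxE eqxx /= mulrC.
apply: (is_derive_eq (is_derive_sum_fun (fun j => is_derive_sqr (D j)))).
rewrite (bigD1 i)//= eqxx mulr1 big1 ?addr0// => j ji.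
by rewrite (negbTE ji) mulr0.
Qed.

Variable k : R.

Lemma sqnorm1_gt0 x : 0 < 1 + sqnorm x.
Proof. by rewrite ltr_pwDl// sqnorm_ge0. Qed.

Lemma continuous_sqnorm1 : continuous (fun x : 'rV[R]_n => 1 + sqnorm x).
Proof.
move=> x; exact: cvgD (@cst_continuous _ _ (1 : R) x) (@continuous_sqnorm x).
Qed.

Lemma continuous_space_weight : continuous (fun x : 'rV[R]_n => (1 + sqnorm x) `^ (- k)).
Proof.
move=> x; apply: (cvg_comp (fun x => 1 + sqnorm x) (fun r => r `^ (- k))).
  exact: continuous_sqnorm1.
exact: is_derive_continuous (is_derive1_powR (- k) (sqnorm1_gt0 x)).
Qed.

(** The i-th component of grad w / w for w = (1 + |x|^2)^(-k). *)
Definition space_drift (i : 'I_n) x : R := - (2 * k) * (x ord0 i / (1 + sqnorm x)).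

Lemma continuous_space_drift i : continuous (space_drift i).
Proof.
move=> x; have x0 : 1 + sqnorm x != 0 by rewrite gt_eqF ?sqnorm1_gt0.
have cx : {for x, continuous (fun y : 'rV[R]_n => y ord0 i)}.
  exact: coord_continuous.
exact: cvgM (@cst_continuous _ _ (- (2 * k)) x)
  (cvgM cx (cvgV x0 (@continuous_sqnorm1 x))).
Qed.

Lemma is_derive_space_weight x i (s : R) :
  is_derive s 1 (fun r : R => (1 + sqnorm (x + r *: delta_mx ord0 i)) `^ (- k))
    (space_drift i (x + s *: delta_mx ord0 i) *
     (1 + sqnorm (x + s *: delta_mx ord0 i)) `^ (- k)).
Proof.
have d1 : is_derive s 1 (fun r : R => 1 + sqnorm (x + r *: delta_mx ord0 i))
    (2 * (x + s *: delta_mx ord0 i) ord0 i).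
  apply: (is_derive_eq (is_derive_add (is_derive_cst (1 : R) s (1 : R))
    (is_derive_sqnorm x i s))).
  by rewrite add0r.
have d2 := @is_derive1_comp R (fun r => r `^ (- k))
  (fun r : R => 1 + sqnorm (x + r *: delta_mx ord0 i)) s _ _
  (is_derive1_powR (- k) (sqnorm1_gt0 (x + s *: delta_mx ord0 i))) d1.
apply: (is_derive_eq d2).
set y := x + s *: delta_mx ord0 i.
have y0 : 1 + sqnorm y != 0 by rewrite gt_eqF ?sqnorm1_gt0.
rewrite powRD ?y0 ?implybT// powR_inv1 ?ltW ?sqnorm1_gt0// /space_drift.
by ring.
Qed.

(** The sum is 4 k^2 s / (1 + s)^2 with s = |x|^2, hence at most k^2; the added 1
    gives a bound that is positive also for k = 0. *)
Lemma space_drift_sqnorm x : \sum_(i < n) space_drift i x ^+ 2 <= k ^+ 2 + 1.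
Proof.
have y0 := sqnorm1_gt0 x; have S0 := sqnorm_ge0 x.
rewrite (eq_bigr (fun i => 4 * k ^+ 2 / (1 + sqnorm x) ^+ 2 * x ord0 i ^+ 2)); last first.
  by move=> i _; rewrite /space_drift; field; rewrite gt_eqF.
rewrite -mulr_sumr -/(sqnorm x); apply: (@le_trans _ _ (k ^+ 2)); last by rewrite lerDl.
rewrite mulrAC ler_pdivrMr ?exprn_gt0//.
have h2 : 0 <= k ^+ 2 * (1 - sqnorm x) ^+ 2 by rewrite mulr_ge0 ?sqr_ge0.
by rewrite -subr_ge0 (_ : _ - _ = k ^+ 2 * (1 - sqnorm x) ^+ 2)//; ring.
Qed.

End space_weight.

(** * The estimate *)

Unset Implicit Arguments.

Theorem theorem3p1 (R : realType) :
  exists C : R, 0 < C /\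
  forall (n : nat) (k : R), (0 < n)%N -> 0 <= k ->
  exists T0 a0 : R, 0 < T0 /\ 0 < a0 /\
  forall (Tm Tp a : R) (u : 'rV[R]_n * R -> R),
    0 < Tm -> Tm < Tp -> Tp <= T0 -> a0 <= a -> test_function Tm Tp u ->
    (slab_integral Tm Tp (fun z : 'rV[R]_n * R =>
        (h z.2 `^ (- (2 * a + 1)) * (1 + sqnorm z.1) `^ (- k) *
        ((a + 1) * u z ^+ 2 + sqnorm (grad_x u z)))%R)
     <= C%:E *
     slab_integral Tm Tp (fun z : 'rV[R]_n * R =>
        (h z.2 `^ (- (2 * a)) * (1 + sqnorm z.1) `^ (- k) *
        `|dt u z + laplacian_x u z| ^+ 2)%R))%E.
Proof.
exists 16; split => // n k n0 k0.
pose kappa : R := k ^+ 2 + 1.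
have kappa1 : 1 <= kappa by rewrite lerDr sqr_ge0.
(* At times up to T0, 16 kappa <= 1/t <= 1/h: this is the absorption of the
   drift term. *)
exists (16 * kappa)^-1, 2; split; first by rewrite invr_gt0; lra.
split => // Tm Tp a u Tm0 TmTp TpT0 a2 testu.
pose P (t : R) := h t `^ (- (2 * a)).
pose Q (t : R) := a * (t^-1 - 1).
pose Q' (t : R) := - (a * t^-1 ^+ 2).
pose H (t : R) := (h t)^-1.
pose W (x : 'rV[R]_n) := (1 + sqnorm x) `^ (- k).
have dP (t : R) : 0 < t -> is_derive t 1 P (- (2 * Q t * P t)).
  move=> t0; apply: (is_derive_eq (is_derive_h_powR (- (2 * a)) t0)).
  by rewrite /Q -/(P t); field; rewrite gt_eqF.
have dQ (t : R) : 0 < t -> is_derive t 1 Q (Q' t) by exact: is_derive_dlog_h.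
have cV (t : R) : 0 < t -> {for t, continuous (fun r : R => r^-1)}.
  by move=> t0; apply: inv_continuous; rewrite gt_eqF.
have cQ' (t : R) : 0 < t -> {for t, continuous Q'}.
  move=> t0; exact: cvgN (cvgM (@cst_continuous _ _ a t) (cvgM (cV t t0) (cV t t0))).
have cpowh (c t : R) : 0 < t -> {for t, continuous (fun r => h r `^ c)}.
  by move=> t0; exact: is_derive_continuous (is_derive_h_powR c t0).
have cH (t : R) : 0 < t -> {for t, continuous H}.
  move=> t0; have h0 : h t != 0 by rewrite gt_eqF ?h_gt0.
  exact: cvgV h0 (is_derive_continuous (is_derive_h (lt0r_neq0 t0))).
have cW : continuous W by exact: continuous_space_weight.
have cb i := @continuous_space_drift R n k i.
have dW := @is_derive_space_weight R n k.
have smu : smooth u by case: testu.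
have cu : continuous_pos u by exact/continuous_pos_continuous/smooth_continuous.
have cDu v : continuous_pos ('D_v u).
  exact/continuous_pos_continuous/smooth_continuous/smooth_derive.
have cWz : continuous_pos (fun z : 'rV[R]_n * R => W z.1) by exact: continuous_pos_space.
have ctw c : continuous_pos (fun z : 'rV[R]_n * R => h z.2 `^ c).
  exact: (@continuous_pos_time R n (fun r => h r `^ c) (cpowh c)).
have cgrad : continuous_pos (fun z => sqnorm (grad_x u z)).
  apply: (@continuous_pos_sum R n n (fun i z => grad_x u z ord0 i ^+ 2)) => i.
  apply: (@continuous_posX _ _ (fun z => grad_x u z ord0 i)).
  by rewrite (_ : (fun z => _) = 'D_(dir_x i) u)//; apply/funext => z; rewrite mxE.
have clap : continuous_pos (laplacian_x u).
  apply: (@continuous_pos_sum R n n (fun i => 'D_(dir_x i) ('D_(dir_x i) u))) => i.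
  by apply/continuous_pos_continuous/smooth_continuous/smooth_derive/smooth_derive.
have closedK : closed (tsupport u) by exact: closed_closure.
have u0 := @off_tsupport _ _ u.
have Du0 v : forall z, ~ tsupport u z -> 'D_v u z = 0 by apply: derive_off_closed closedK u0.
have DDu0 v w : forall z, ~ tsupport u z -> 'D_w ('D_v u) z = 0.
  exact: derive_off_closed closedK (@Du0 v).
have [B HB] := test_function_box testu.
apply: (@slab_integral_le R n Tm Tp Tm0 _ _
   (carleman_density u P Q Q' H W (@space_drift R n k)) B 16).
- apply: continuous_posM; first by apply: continuous_posM => //; exact: ctw.
  apply: continuous_posD => //; apply: continuous_posM; first exact: continuous_pos_cst.
  exact: continuous_posX.
- apply: continuous_posM; first by apply: continuous_posM => //; exact: ctw.
  rewrite (_ : (fun z => _) = (fun z => (dt u z + laplacian_x u z) ^+ 2)); last first.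
    by apply/funext => z; rewrite real_normK ?num_real.
  by apply: continuous_posX; apply: continuous_posD => //; exact: (@cDu (@dir_t R n)).
- exact: (@continuous_carleman_density R n Tm Tp u testu P Q Q' H W).
- move=> z /HB nz; rewrite u0// expr0n /= mulr0 add0r.
  have -> : sqnorm (grad_x u z) = 0; last by rewrite mulr0.
  by apply: big1 => i _; rewrite mxE Du0// expr0n.
- move=> z /HB nz; rewrite /dt /laplacian_x Du0// add0r big1 => [|i _]; last exact: DDu0.
  by rewrite normr0 expr0n /= mulr0.
- move=> z /HB; exact: (@carleman_density_off_tsupport R n Tm Tp u testu P Q Q' H W).
- move=> z /andP[zm zp].
  have t0 : 0 < z.2 by exact: lt_trans zm.
  have kt : 16 * kappa <= z.2^-1.
    rewrite -[leLHS]invrK lef_pV2 ?posrE ?invr_gt0//; last by lra.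
    by rewrite (le_trans _ TpT0)// ltW.
  have t1 : 2 * z.2 <= 1 by rewrite -ler_pdivlMr// mul1r; lra.
  have [H1 H2 H3] := h_inv_bounds t0 t1.
  have S0 : 0 <= sqnorm (grad_x u z) by exact: sqnorm_ge0.
  have ES : (\sum_(i < n) space_drift k i z.1 * 'D_(dir_x i) u z) ^+ 2 <=
      kappa * sqnorm (grad_x u z).
    have -> : sqnorm (grad_x u z) = \sum_(i < n) 'D_(dir_x i) u z ^+ 2.
      by apply: eq_bigr => i _; rewrite mxE.
    by apply: cauchy_schwarz_sum; [lra|exact: space_drift_sqnorm].
  have t2 : 2 <= z.2^-1 by lra.
  have H0 : 0 < H z.2 by rewrite invr_gt0 h_gt0.
  have QH : Q z.2 * H z.2 <= a * z.2^-1 ^+ 2.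
    by rewrite -mulrA ler_wpM2l//; lra.
  have := carleman_pointwise (laplacian_x u z) (u z) (dt u z) a2 t2 S0 H0 H1 QH
    (le_trans kt H3) ES.
  have PW0 : 0 <= P z.2 * W z.1 by rewrite mulr_ge0 ?powR_ge0.
  have hP : h z.2 `^ (- (2 * a + 1)) = P z.2 * H z.2.
    have h0 := h_gt0 t0; have h0' : h z.2 != 0 by rewrite gt_eqF.
    by rewrite opprD powRD ?h0' ?implybT// powR_inv1// ltW.
  rewrite hP -/(P z.2) -/(W z.1) /carleman_density /drift_laplacian.
  rewrite real_normK ?num_real//.
  move=> /(ler_wpM2l PW0).
  set E := \sum_(i < n) _.
  rewrite -/(Q' z.2) => pw.
  rewrite [leRHS]mulrCA; apply: le_trans pw; rewrite le_eqVlt; apply/orP; left.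
  by apply/eqP; ring.
- exact: (@carleman_identity R n Tm Tp u Tm0 TmTp testu P Q Q' H W).
Qed.
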